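(* For any diagram $D=(k,m,r,P,Q)$, the collection $\mathcal{B}(D)$ of label-sets of b-paths of $D$ is the set of bases of a multi-path matroid on $[m+r]$.
   Context: A diagram is a 5-tuple $D=(k,m,r,P,Q)$ where $k$ is a positive integer, $m,r$ are non-negative integers, $P$ is a lattice path (steps $E=(1,0)$, $N=(0,1)$) from $(k-1,0)$ to $(k-1+m,r)$, and $Q$ is a lattice path from $(0,k-1)$ to $(m,k-1+r)$ that never goes below $P$. For $1\le i\le k$ let $p_i=(k-i,i-1)$ and $p'_i=p_i+(m,r)$; let $L,L'$ be the lines of slope $-1$ containing the $p_i$, resp. the $p'_i$. The region $R(D)$ is the set of points of $\mathbb{R}^2$, including the boundary, enclosed by $P$, $Q$, $L$, $L'$. An edge of $D$ (a unit segment between lattice points of $R(D)$) gets label $i$ if it is the $i$-th step of some lattice path starting at a point of $L$. A b-path is a lattice path contained in $R(D)$ from some $p_i$ to the corresponding $p'_i$; its label-set is the set of labels of its North steps. A multi-path matroid is a transversal matroid (matroid whose independent sets are the partial transversals of a multiset of subsets of the ground set) having a presentation by an antichain (no member containing another) of $\sigma$-intervals (nonempty sets $\{f,\sigma(f),\ldots,l\}$) for some cyclic permutation $\sigma$ of the ground set. *)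

(* Defs.v *)
From HB Require Import structures.
From mathcomp Require Import all_boot all_order all_algebra all_fingroup.
From mathcomp Require Import boolp classical_sets reals.

Set Implicit Arguments.
Unset Strict Implicit.
Unset Printing Implicit Defensive.

Import Order.TTheory GRing.Theory Num.Theory.
Local Open Scope ring_scope.

Record matroid (T : finType) := Matroid {
  indep : {set {set T}};
  indep0 : finset.set0 \in indep;
  indep_sub : forall X Y : {set T},
    X \subset Y -> Y \in indep -> X \in indep;
  indep_aug : forall X Y : {set T},
    X \in indep -> Y \in indep -> (#|X| < #|Y|)%N ->
    exists2 y, y \in Y :\: X & y |: X \in indep }.

Definition bases (T : finType) (M : matroid T) : {set {set T}} :=
  [set B : {set T} | maxset (mem (indep M)) B]%SET.

(** A multiset of subsets of [T] is listed as a sequence. An element of [X] is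
    matched to a position in the sequence; [x \in nth set0 A j] forces
    [j < size A]. *)
Definition partial_transversal (T : finType) (A : seq {set T}) (X : {set T}) :=
  exists2 f : T -> nat, {in X &, injective f}
    & forall x, x \in X -> x \in nth finset.set0 A (f x).

Definition presentation (T : finType) (M : matroid T) (A : seq {set T}) :=
  forall X : {set T}, X \in indep M <-> partial_transversal A X.

Definition cyclic_perm (T : finType) (sigma : {perm T}) :=
  forall x y : T, y \in porbit sigma x.

(** The set {f, sigma f, ..., l} with [l = iter n sigma f]. *)
Definition sigma_interval (T : finType) (sigma : {perm T}) (I : {set T}) :=
  exists f : T, exists n : nat, I = [set x in traject sigma f n.+1]%SET.

(** Comparing distinct positions, so a set listed twice is not allowed. *)
Definition antichain (T : finType) (A : seq {set T}) :=
  forall i j, (i < size A)%N -> (j < size A)%N -> i != j ->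
    ~~ (nth finset.set0 A i \subset nth finset.set0 A j).

Definition multi_path_matroid (T : finType) (M : matroid T) :=
  exists (sigma : {perm T}) (A : seq {set T}),
    [/\ cyclic_perm sigma,
        forall I, I \in A -> sigma_interval sigma I,
        antichain A
      & presentation M A].

Inductive step := East | North.

Definition move (z : int * int) (s : step) : int * int :=
  match s with
  | East => (z.1 + 1, z.2)
  | North => (z.1, z.2 + 1)
  end.

Record lattice_path := LatticePath {
  source : int * int;
  steps : seq step }.

Definition path_length (W : lattice_path) : nat := size (steps W).

(** The point reached after [j] steps; constant for [j >= path_length W]. *)
Definition vertex (W : lattice_path) (j : nat) : int * int :=
  foldl move (source W) (take j (steps W)).

Definition target (W : lattice_path) : int * int := vertex W (path_length W).

(** An edge is given by its lower-left end and its direction. *)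
Definition edge := ((int * int) * step)%type.

(** [e] is the [i]-th step of [W], counting from 1. *)
Definition is_step (W : lattice_path) (i : nat) (e : edge) :=
  (0 < i <= path_length W)%N /\
  e = (vertex W i.-1, nth East (steps W) i.-1).

(** The subset of the plane traced by [W]. Beyond the end of the path the
    segments are degenerate, equal to the target; in particular a path without
    steps traces its source. *)
Definition trace (R : realType) (W : lattice_path) : set (R * R) :=
  [set z | exists j : nat, exists2 t : R, 0 <= t <= 1 &
     z = ((1 - t) * (vertex W j).1%:~R + t * (vertex W j.+1).1%:~R,
          (1 - t) * (vertex W j).2%:~R + t * (vertex W j.+1).2%:~R)]%classic.
Arguments trace : clear implicits.

(** [Q] starts on the same line of slope -1 as [P], so their [j]-th vertices
    lie on a common line of slope -1; "never below" compares them there. *)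
Record diagram := Diagram {
  dk : nat;
  dm : nat;
  dr : nat;
  dP : lattice_path;
  dQ : lattice_path;
  dk_gt0 : (0 < dk)%N;
  source_dP : source dP = (dk%:Z - 1, 0);
  target_dP : target dP = (dk%:Z - 1 + dm%:Z, dr%:Z);
  source_dQ : source dQ = (0, dk%:Z - 1);
  target_dQ : target dQ = (dm%:Z, dk%:Z - 1 + dr%:Z);
  dQ_not_below_dP : forall j, (vertex dP j).2 <= (vertex dQ j).2 }.

Definition p_start (D : diagram) (i : nat) : int * int :=
  ((dk D)%:Z - i%:Z, i%:Z - 1).

Definition p_end (D : diagram) (i : nat) : int * int :=
  ((p_start D i).1 + (dm D)%:Z, (p_start D i).2 + (dr D)%:Z).

(** The points in the closed strip between the lines L : x + y = k - 1 and
    L' : x + y = k - 1 + m + r that, on the line of slope -1 through them, lie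
    weakly between the point [a] of [P] and the point [b] of [Q]. *)
Definition region (R : realType) (D : diagram) : set (R * R) :=
  [set z | (dk D)%:R - 1 <= z.1 + z.2 <= (dk D)%:R - 1 + (dm D)%:R + (dr D)%:R
    /\ exists a b : R * R,
       [/\ trace R (dP D) a, trace R (dQ D) b,
           a.1 + a.2 = z.1 + z.2, b.1 + b.2 = z.1 + z.2
         & a.2 <= z.2 <= b.2]]%classic.
Arguments region : clear implicits.

Definition has_label (D : diagram) (e : edge) (i : nat) :=
  exists2 W : lattice_path,
    (source W).1 + (source W).2 = (dk D)%:Z - 1 & is_step W i e.

Definition b_path (R : realType) (D : diagram) (W : lattice_path) :=
  (trace R W `<=` region R D)%classic /\
  exists2 i : nat, (1 <= i <= dk D)%N
    & source W = p_start D i /\ target W = p_end D i.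
Arguments b_path : clear implicits.

(** The ground set [m + r] = {1, ..., m + r} is the type ['I_(m + r)], whose
    element [x] stands for the label [x.+1]. *)
Definition label_set (D : diagram) (W : lattice_path) :
    {set 'I_(dm D + dr D)} :=
  [set x : 'I_(dm D + dr D) |
    `[< exists j z, is_step W j (z, North) /\ has_label D (z, North) x.+1 >]]%SET.

Definition label_sets (R : realType) (D : diagram) :
    set {set 'I_(dm D + dr D)} :=
  [set B | exists2 W, b_path R D W & B = label_set D W]%classic.
Arguments label_sets : clear implicits.

(* Main.v *)
Require Import Defs.
From mathcomp Require Import boolp classical_sets reals.
From mathcomp Require Import all_boot all_order all_algebra all_fingroup.
From mathcomp Require Import zify lra.

Set Implicit Arguments.
Unset Strict Implicit.
Unset Printing Implicit Defensive.

Import Order.TTheory GRing.Theory Num.Theory.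

(** Record a path by the heights [h j] it has gained after [j] steps, continued
    periodically: [h (j + n) = h j + r] with [n = m + r].  A set [B] of size [r]
    is a label-set iff some translate [s + b j] of its height function stays
    between those of [P] and [Q].  In row [t] the diagram offers the North
    labels between the crossing [q t] of [Q] and the crossing [p (t + k - 1)]
    of [P], read modulo [n], and these [r] cyclic intervals present the matroid;
    conversely a transversal gives a path by counting the rows that meet the
    steps from [i] to [j].

    The intervals may wrap around the whole ground set, which would destroy the
    antichain condition.  They are therefore cut at [q t + (n - r)]: pushing a
    path up until it touches [Q] shows that no label-set is lost. *)

(** * Height functions of periodic step sequences and their crossings *)

Definition height (u : pred nat) (j : nat) := count u (iota 0 j).

Definition periodic (n r : nat) (u : pred nat) :=
  (forall y, u (y + n) = u y) /\ height u n = r.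

(** [p t] is the index of North step number [t], counting from 0. The Galois form makes comparisons
    of crossings into comparisons of heights. *)
Definition position (u : pred nat) (p : nat -> nat) :=
  forall t x, (p t <= x) = (t < height u x.+1).

Section Heights.
Variables (n r : nat) (u : pred nat).

Lemma heightD j d : height u (j + d) = height u j + count u (iota j d).
Proof. by rewrite /height iotaD count_cat. Qed.

Lemma heightS j : height u j.+1 = height u j + u j.
Proof. by rewrite -addn1 heightD /= addn0. Qed.

Lemma leq_height i j : i <= j -> height u i <= height u j.
Proof. by move=> /subnKC <-; rewrite heightD leq_addr. Qed.

Lemma height_lipschitz j d : height u (j + d) <= height u j + d.
Proof. by rewrite heightD leq_add2l -{2}(size_iota j d) count_size. Qed.

Hypothesis per : periodic n r u.

Lemma height_period j : height u (j + n) = height u j + r.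
Proof.
case: per => pu <-; elim: j => [|j IH]; first by rewrite add0n.
by rewrite addSn !heightS IH pu; lia.
Qed.

Lemma height_periodM j c : height u (j + c * n) = height u j + c * r.
Proof.
elim: c => [|c IH]; first by rewrite !mul0n !addn0.
by rewrite !mulSnr addnA height_period IH addnA.
Qed.

Lemma periodic_modn y : u (y %% n) = u y.
Proof.
case: per => pu _; rewrite {2}(divn_eq y n) addnC.
by elim: (y %/ n) => [|c IH]; rewrite ?addn0 // mulSnr addnA pu.
Qed.

Lemma height_divn j : height u j = height u (j %% n) + j %/ n * r.
Proof. by rewrite -height_periodM addnC -divn_eq. Qed.

Lemma leq_period : r <= n.
Proof. by case: per => _ <-; rewrite /height -{2}(size_iota 0 n) count_size. Qed.

Lemma position_exists : 0 < r -> exists p, position u p.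
Proof.
move=> r0; suff ex t : {y | forall x, (y <= x) = (t < height u x.+1)}.
  by exists (fun t => sval (ex t)) => t; exact: (svalP (ex t)).
have wit : exists x, t < height u x.+1.
  exists (t.+1 * n).
  apply: (@leq_trans (height u (0 + t.+1 * n))); last by rewrite add0n leq_height.
  by rewrite height_periodM; nia.
exists (ex_minn wit) => x; case: ex_minnP => y hy ymin.
apply/idP/idP => [yx|]; last exact: ymin.
by apply: (leq_trans hy); rewrite leq_height.
Qed.

Variable p : nat -> nat.
Hypothesis pos : position u p.

Lemma position_ge t x : (x <= p t) = (height u x <= t).
Proof. by case: x => [|x] //; rewrite ltnNge pos -leqNgt. Qed.

Lemma position_ltS t : p t < p t.+1.
Proof.
rewrite ltnNge pos -leqNgt heightS.
have : height u (p t) <= t by rewrite -position_ge.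
by case: (u _); lia.
Qed.

Lemma position_lt s t : s < t -> p s < p t.
Proof.
elim: t => // t IH; rewrite ltnS leq_eqVlt => /orP[/eqP->|/IH H].
  exact: position_ltS.
exact: ltn_trans H (position_ltS t).
Qed.

Lemma position_period t : p (t + r) = p t + n.
Proof.
suff H x : (p (t + r) <= x) = (p t + n <= x).
  by apply/eqP; rewrite eqn_leq H leqnn -H leqnn.
rewrite pos; have [xn|nx] := leqP n x.
  have := height_period (x - n).+1; rewrite addSn subnK // => ->.
  by rewrite ltn_add2r -pos; lia.
have -> : (p t + n <= x) = false by lia.
have := leq_height nx; case: per => _ ->; lia.
Qed.

Lemma position_periodM t c : p (t + c * r) = p t + c * n.
Proof.
elim: c => [|c IH]; first by rewrite !mul0n !addn0.
by rewrite !mulSnr addnA position_period IH addnA.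
Qed.

Lemma position_bound t : t < r -> p t < n.
Proof.
move=> tr; have n0 : 0 < n by have := leq_period; lia.
by rewrite -(prednK n0) ltnS pos prednK //; case: per => _ ->.
Qed.

End Heights.

(** * Transversal matroids of a sequence of sets *)

Section Transversals.
Variables (T : finType) (A : seq {set T}).

Lemma transversal_augment (X Y : {set T}) :
  partial_transversal A X -> partial_transversal A Y -> #|X| < #|Y| ->
  exists2 y, y \in Y :\: X & partial_transversal A (y |: X).
Proof.
move=> [f fi fA] [g gi gA] XY.
move Em : (#|X| - #|[set x in X | f x == g x]|)%N => m.
elim/ltn_ind: m f fi fA Em => m IH f fi fA Em.
have [y yY yn] : exists2 y, y \in Y & g y \notin [seq f x | x in X].
  apply/exists_inP; move: XY; apply: contraLR; rewrite negb_exists -leqNgt => /forallP H.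
  rewrite -(size_image f X) -(size_image g Y); apply: uniq_leq_size.
    by rewrite map_inj_in_uniq ?enum_uniq // => a b; rewrite !mem_enum; exact: gi.
  move=> _ /imageP[y yY ->]; move: (H y); rewrite negb_and yY /=.
  by rewrite negbK.
have fny x : x \in X -> f x != g y.
  by move=> xX; apply: contraNneq yn => <-; apply: image_f.
pose f' x := if x == y then g y else f x.
have fi' : {in y |: X &, injective f'}.
  move=> a b; rewrite !inE /f'.
  case: eqVneq => [->|ay] /=; case: eqVneq => [->|bey] //=.
  - by move=> _ bX E; move: (fny _ bX); rewrite E eqxx.
  - by move=> aX _ E; move: (fny _ aX); rewrite E eqxx.
  - exact: fi.
have fA' x : x \in y |: X -> x \in nth set0 A (f' x).
  rewrite !inE /f'; case: eqVneq => [-> _|_] /=; [exact: gA|exact: fA].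
have [yX|yX] := boolP (y \in X); last first.
  by exists y; [rewrite inE yX|exists f'].
have Xy : y |: X = X by apply/setUidPr; rewrite sub1set.
rewrite Xy in fi' fA'.
apply: (IH _ _ f' fi' fA' erefl); rewrite -Em.
have sub : [set x in X | f x == g x] \proper [set x in X | f' x == g x].
  apply/properP; split.
    apply/subsetP => x; rewrite !inE /f' => /andP[-> E] /=.
    by case: (eqVneq x y) => [->|].
  exists y; first by rewrite !inE yX /f' !eqxx.
  by rewrite !inE yX (negbTE (fny _ yX)).
have := proper_card sub.
have : #|[set x in X | f' x == g x]| <= #|X|.
  by apply: subset_leq_card; apply/subsetP => x; rewrite inE => /andP[].
lia.
Qed.

Definition transversal_indep : {set {set T}} :=
  [set X | `[< partial_transversal A X >]]%SET.

Lemma transversal_indep0 : set0 \in transversal_indep.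
Proof. by rewrite inE; apply/asboolP; exists (fun=> 0) => x; rewrite inE. Qed.

Lemma transversal_indep_sub (X Y : {set T}) :
  X \subset Y -> Y \in transversal_indep -> X \in transversal_indep.
Proof.
rewrite !inE => /subsetP XY /asboolP[f fi fA]; apply/asboolP; exists f.
  by move=> x y /XY xY /XY yY; exact: fi.
by move=> x /XY; exact: fA.
Qed.

Lemma transversal_indep_aug (X Y : {set T}) :
  X \in transversal_indep -> Y \in transversal_indep -> #|X| < #|Y| ->
  exists2 y, y \in Y :\: X & y |: X \in transversal_indep.
Proof.
rewrite !inE => /asboolP tX /asboolP tY XY.
have [y yYX ty] := transversal_augment tX tY XY.
by exists y => //; rewrite inE; apply/asboolP.
Qed.

Definition transversal_matroid := Matroid
  transversal_indep0 transversal_indep_sub transversal_indep_aug.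

Lemma transversal_presentation : presentation transversal_matroid A.
Proof. by move=> X; rewrite inE; split => /asboolP. Qed.

Lemma transversal_lt_size (X : {set T}) (f : T -> nat) :
  (forall x, x \in X -> x \in nth set0 A (f x)) ->
  forall x, x \in X -> f x < size A.
Proof.
move=> fA x /fA; rewrite ltnNge; apply: contraTN => sA.
by rewrite nth_default ?inE.
Qed.

Lemma transversal_card (X : {set T}) :
  partial_transversal A X -> #|X| <= size A.
Proof.
move=> [f fi fA]; rewrite -(size_image f X) -(size_iota 0 (size A)).
apply: uniq_leq_size.
  by rewrite map_inj_in_uniq ?enum_uniq // => a b; rewrite !mem_enum; exact: fi.
by move=> _ /imageP[x /(transversal_lt_size fA) xA ->]; rewrite mem_iota.
Qed.

(** Augmenting from [X0] shows that a maximal partial transversal fills every position. *)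
Lemma transversal_bases (X0 B : {set T}) :
  partial_transversal A X0 -> #|X0| = size A ->
  (B \in bases transversal_matroid <->
     partial_transversal A B /\ #|B| = size A).
Proof.
move=> tX0 cX0; rewrite inE; split.
  move=> /maxsetP[]; rewrite /= inE => /asboolP tB Bmax; split=> //.
  apply/eqP; rewrite eqn_leq transversal_card //= leqNgt; apply/negP => ltB.
  rewrite -cX0 in ltB.
  have [y] := transversal_augment tB tX0 ltB; rewrite inE => /andP[yB _] ty.
  have E : y |: B = B.
    by apply: Bmax; [rewrite /= inE; apply/asboolP|exact: subsetUr].
  by move: yB; rewrite -E !inE eqxx.
move=> [tB cB]; apply/maxsetP; rewrite /= inE; split; first exact/asboolP.
move=> C; rewrite /= inE => /asboolP tC BC; apply/eqP.
by rewrite eq_sym eqEcard BC cB transversal_card.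
Qed.

End Transversals.

(** * Cyclic arcs and the paths between two boundary paths *)

Definition between (u v : pred nat) (K : nat) (w : pred nat) :=
  exists s, forall j, height u j <= s + height w j <= K + height v j.

Section Arcs.
Variables (n r K : nat) (u v : pred nat) (p q : nat -> nat).
Hypotheses (peru : periodic n r u) (perv : periodic n r v) (r_gt0 : 0 < r).
Hypothesis (uv : forall j, height u j <= K + height v j).
Hypotheses (posu : position u p) (posv : position v q).

(** The upper path starts [K] above the lower one, so step [t] of [v] and step [t + K] of [u] lie in
    the same row. The second bound leaves at most [n - r + 1] labels in an arc. *)
Definition arc_end (t : nat) := minn (p (t + K)) (q t + (n - r)).

Definition cyclic_arc (t : nat) : {set 'I_n} :=
  [set x : 'I_n | has (fun y => y %% n == x)
                      (iota (q t) (arc_end t - q t).+1)]%SET.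

Let le_rn : r <= n. Proof. exact: leq_period peru. Qed.
Let n_gt0 : 0 < n. Proof. exact: leq_trans r_gt0 le_rn. Qed.

(** The lower path cannot complete a row before the upper one does. *)
Lemma arc_start_le_end t : q t <= arc_end t.
Proof.
rewrite leq_min leq_addr andbT posv.
have : t + K < height u (p (t + K)).+1 by rewrite -posu.
have := uv (p (t + K)).+1; lia.
Qed.

Lemma arc_end_period t c : arc_end (t + c * r) = arc_end t + c * n.
Proof.
rewrite /arc_end (position_periodM perv posv) addnAC.
by rewrite (position_periodM peru posu) addnAC addn_minl.
Qed.

Lemma arc_end_lt s t : s < t -> arc_end s < arc_end t.
Proof.
move=> st; have := position_lt posv st.
have : p (s + K) < p (t + K) by apply: (position_lt posu); rewrite ltn_add2r.
rewrite /arc_end; lia.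
Qed.

Lemma mem_cyclic_arc t (x : 'I_n) :
  reflect (exists2 y, q t <= y <= arc_end t & y %% n = x) (x \in cyclic_arc t).
Proof.
have le := arc_start_le_end t.
rewrite inE; apply: (iffP hasP) => [[y yi /eqP E]|[y yi E]]; exists y => //.
- by move: yi; rewrite mem_iota; lia.
- by rewrite mem_iota; lia.
- exact/eqP.
Qed.

(** A North step is matched to its row modulo [r]; the [r] North steps of one period occupy
    consecutive rows, hence distinct residues. *)
Lemma between_transversal w : periodic n r w -> between u v K w ->
  exists2 f : nat -> nat,
    forall x x', x < n -> x' < n -> w x -> w x' -> f x = f x' -> x = x'
    & forall x : 'I_n, w x -> f x < r /\ x \in cyclic_arc (f x).
Proof.
move=> perw btw.
pose P s := all (fun j => s + height w j <= K + height v j) (iota 0 n).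
have PE s : P s -> forall j, s + height w j <= K + height v j.
  move=> /allP Ps j; have := Ps (j %% n).
  rewrite mem_iota ltn_pmod // (height_divn perw j) (height_divn perv j).
  by move=> /(_ isT); lia.
have exP : exists s, P s.
  case: btw => s H; exists s; apply/allP => j _; by case/andP: (H j).
have ubP s : P s -> s <= K.
  by move=> /PE /(_ 0); rewrite /height /= !addn0.
(* The highest translate of the path touches the upper path, which forces the
   crossings to lie in the truncated arcs. *)
case: (ex_maxnP exP ubP) => s /PE sv smax.
have us j : height u j <= s + height w j.
  case: btw => s' H; have /andP[le1 _] := H j.
  apply: (leq_trans le1); rewrite leq_add2r; apply: smax.
  by apply/allP => i _; case/andP: (H i).
have [j1 j1n touch] : exists2 j, j < n & s + height w j = K + height v j.
  have : ~~ P s.+1 by apply/negP => /smax; rewrite ltnn.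
  rewrite -has_predC => /hasP[j]; rewrite mem_iota /= add0n => jn ltj.
  by exists j => //; have := sv j; lia.
(* The row of [x] is [s + height w x - K], possibly negative; adding the multiple [K.+1 * r] of [r]
   keeps the subtraction exact and preserves the residue. *)
have Kr : K <= K.+1 * r by rewrite -{1}[K]muln1 leq_mul.
pose t x := s + height w x + K.+1 * r - K.
have wlt x x' : x < x' -> w x -> height w x < height w x'.
  move=> xx' wx; have := leq_height w xx'; rewrite heightS wx; lia.
exists (fun x => t x %% r) => [x x' xn x'n wx wx' E|x wx].
  have hr y : y < n -> w y -> height w y < r.
    by move=> yn wy; have := wlt _ _ yn wy; case: perw => _ ->.
  have bx := hr _ xn wx; have bx' := hr _ x'n wx'.
  have/eqP : height w x = height w x' %[mod r].
    apply/eqP; rewrite -(eqn_modDl (s + K.+1 * r - K)).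
    have tE y : t y = s + K.+1 * r - K + height w y by rewrite /t; lia.
    by rewrite -!tE E.
  rewrite !modn_small // => /eqP Eh.
  case: (ltngtP x x') => // lt; [have := wlt _ _ lt wx|have := wlt _ _ lt wx'];
    by rewrite Eh ltnn.
split; first by rewrite ltn_mod.
(* [X] is [x] moved by the same [K.+1] periods, so that it lies in row [t x], at height [T]. *)
pose X := x + K.+1 * n; pose T := t x + K.
have TE : T = s + height w X.
  by rewrite /T /t /X (height_periodM perw); lia.
have wX : w X by rewrite -(periodic_modn perw) /X addnC modnMDl modn_small.
have qX : q (t x) <= X.
  by rewrite posv; have := sv X.+1; rewrite heightS wX; lia.
have Xp : X <= p T by rewrite (position_ge posu) TE.
have Xq : X <= q (t x) + (n - r).
  suff : X - (n - r) <= q (t x) by lia.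
  rewrite (position_ge posv).
  (* By periodicity a touching point can be chosen less than one period before [X]. *)
  have [j [jX Xj tj]] : exists j, [/\ j <= X, X < j + n &
      s + height w j = K + height v j].
    have tc c : s + height w (j1 + c * n) = K + height v (j1 + c * n).
      by rewrite (height_periodM perw) (height_periodM perv); lia.
    have xn := ltn_ord x.
    have [le|lt] := leqP j1 x.
      by exists (j1 + K.+1 * n); split => //; rewrite /X; lia.
    by exists (j1 + K * n); split => //; rewrite /X mulSn; lia.
  set y := X - (n - r).
  (* Up to the touching point monotonicity suffices. Beyond it, [v] gains at most [y - j] from [j]
     to [y], while [w] gains at least [r - (j + n - X)], the same number, from [j] to [X]. *)
  have [yj|jy] := leqP y j.
    have := leq_height v yj; have := leq_height w jX; lia.
  have nrX : n - r <= X by rewrite /X mulSn; lia.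
  have := height_lipschitz v j (y - j); rewrite subnKC; last lia.
  have := height_lipschitz w X (j + n - X); rewrite subnKC; last lia.
  rewrite (height_period perw); lia.
(* Moving back by [t x %/ r] periods brings the row below [r] and keeps the label modulo [n]. *)
have tE := divn_eq (t x) r.
have qE : q (t x) = q (t x %% r) + t x %/ r * n.
  by rewrite -(position_periodM perv posv) addnC -tE.
have pE : p T = p (t x %% r + K) + t x %/ r * n.
  by rewrite -(position_periodM peru posu) addnAC [_ %% _ + _]addnC -tE.
apply/mem_cyclic_arc; exists (X - t x %/ r * n); first by rewrite /arc_end; lia.
have : X - t x %/ r * n + t x %/ r * n = x + K.+1 * n by rewrite subnK //; lia.
move=> /(congr1 (modn^~ n)); rewrite !(addnC _ (_ * n)) !modnMDl => ->.
by rewrite modn_small.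
Qed.

(** A translate fits as soon as every lower bound [height u i - height w i] on [s] is at most every
    upper bound [K + height v j - height w j]. This is [key], which counts the North steps of [w]
    from [i] to [j] by the distinct rows assigned to them. *)
Lemma transversal_between w (f : nat -> nat) : periodic n r w ->
  (forall x x', x < n -> x' < n -> w x -> w x' -> f x = f x' -> x = x') ->
  (forall x : 'I_n, w x -> f x < r /\ x \in cyclic_arc (f x)) ->
  between u v K w.
Proof.
move=> perw finj farc.
(* The shift by one period keeps the row indices nonnegative. *)
have rowE x : exists T, x < n -> w x ->
    [/\ T = f x + K %[mod r], height u (x + n) <= T & T < K + height v (x + n).+1].
  have [xn|] := boolP (x < n); last by exists 0.
  have [wx|] := boolP (w x); last by exists 0.
  have [fr /mem_cyclic_arc[y /andP[qy ye] yx]] := farc (Ordinal xn) wx.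
  rewrite /= in fr qy ye yx.
  (* An arc starts below [n] and ends at most [n - r] later, so [y] is [x] or [x + n]. In the first
     case the row is raised by [r] to follow the shift. *)
  have y2n : y < n + n.
    have := position_bound perv posv fr; move: ye; rewrite /arc_end; lia.
  have hup : height u y <= f x + K.
    by rewrite -(position_ge posu); move: ye; rewrite /arc_end; lia.
  have hvq : f x < height v y.+1 by rewrite -posv.
  have [yn|ny] := ltnP y n.
    have xy : x = y by rewrite -yx modn_small.
    exists (f x + K + r) => _ _; rewrite -(addSn x) modnDr.
    rewrite (height_period peru) (height_period perv).
    by rewrite -xy in hup hvq; split => //; lia.
  have -> : x + n = y.
    by rewrite -yx -{1}(subnK ny) modnDr modn_small; lia.
  by exists (f x + K) => _ _; split => //; lia.
have [T HT] : exists T : nat -> nat, forall x, x < n -> w x ->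
    [/\ T x = f x + K %[mod r], height u (x + n) <= T x
      & T x < K + height v (x + n).+1].
  by have [T HT] := boolp.choice rowE; exists T.
have key i j : i <= j -> height u i + height w j <= K + height v j + height w i.
  move=> ij; rewrite -(subnKC ij) (heightD w).
  set d := j - i.
  suff : count w (iota i d) <= K + height v (i + d) - height u i.
    have := uv i; have := leq_height v (leq_addr d i); lia.
  (* The row assignment is continued to all steps: one period to the right is [r] rows up. *)
  pose g y := T (y %% n) + y %/ n * r.
  have gP y : w y -> height u (y + n) <= g y < K + height v (y + n).+1.
    move=> wy; have [||_ h1 h2] := HT (y %% n).
    - by rewrite ltn_mod.
    - by rewrite (periodic_modn perw).
    have E : y + n = y %% n + n + y %/ n * n by rewrite {1}(divn_eq y n); lia.
    rewrite E -addSn (height_periodM peru) (height_periodM perv) /g; lia.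
  (* Modulo [r] the value [g y] determines [f (y %% n)], hence [y %% n]; the quotient by [n] then
     follows. *)
  have ginj : {in [seq y <- iota i d | w y] &, injective g}.
    move=> y y'; rewrite !mem_filter => /andP[wy _] /andP[wy' _] E.
    have wm z : w z -> z %% n < n /\ w (z %% n).
      by rewrite ltn_mod (periodic_modn perw).
    have [lt1 w1] := wm _ wy; have [lt2 w2] := wm _ wy'.
    have [E1 _ _] := HT _ lt1 w1; have [E2 _ _] := HT _ lt2 w2.
    have Em : y %% n = y' %% n.
      apply: finj => //.
      have [] : f (y %% n) < r /\ f (y' %% n) < r.
        by split; [case: (farc (Ordinal lt1) w1)|case: (farc (Ordinal lt2) w2)].
      move=> /modn_small <- /modn_small <-.
      apply/eqP; rewrite -(eqn_modDr K) -E1 -E2; apply/eqP.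
      move/(congr1 (modn^~ r)): E; rewrite /g.
      by rewrite !(addnC _ (_ * r)) !modnMDl.
    have Ed : y %/ n = y' %/ n.
      by move: E; rewrite /g Em => /addnI/eqP; rewrite eqn_pmul2r // => /eqP.
    by rewrite (divn_eq y n) (divn_eq y' n) Em Ed.
  (* The rows used lie in an interval of the required length, both of whose ends carry an extra [r]
     from the shift by one period. *)
  rewrite -size_filter -(size_map g) -(size_iota (height u i + r)
    (K + height v (i + d) - height u i)).
  apply: uniq_leq_size.
    by rewrite map_inj_in_uniq // filter_uniq // iota_uniq.
  move=> z /mapP[y]; rewrite mem_filter mem_iota => /andP[wy yi] {z}->.
  have := gP _ wy; rewrite mem_iota.
  have : height u (i + n) <= height u (y + n) by apply: leq_height; lia.
  have : height v (y + n).+1 <= height v (i + d + n) by apply: leq_height; lia.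
  rewrite !(height_period peru, height_period perv); lia.
(* Moving [j] right by [i] periods removes the condition [i <= j]. *)
have key' i j : height u i + height w j <= K + height v j + height w i.
  have := @key i (j + i * n); rewrite (height_periodM perw) (height_periodM perv).
  by move=> H; have := H ltac:(nia); lia.
(* The least translate above the lower path touches it at some [i]; [key'] at that [i] gives the
   upper bound. *)
pose P s := all (fun j => height u j <= s + height w j) (iota 0 n).
have exP : exists s, P s.
  exists (height u n); apply/allP => j; rewrite mem_iota => jn.
  by apply: leq_trans (leq_addr _ _); apply: leq_height; lia.
case: (ex_minnP exP) => s /allP Ps smin.
have [i iE] : exists i, s + height w i <= height u i.
  case: s Ps smin => [|s] Ps smin; first by exists 0.
  have : ~~ P s by apply/negP => /smin; rewrite ltnn.
  by rewrite -has_predC => /hasP[i _] /= H; exists i; lia.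
exists s => j; apply/andP; split; last by have := key' i j; lia.
have := Ps (j %% n); rewrite mem_iota ltn_pmod //= => /(_ isT).
rewrite (height_divn peru j) (height_divn perw j); lia.
Qed.

(** For [r > 1] an arc is shorter than a full turn, so inclusion of residues lifts to inclusion of
    integer intervals after a shift by [c] periods. Both ends of the arcs strictly increase with the
    row, so comparing them gives [t = s + c * r], and [c = 0]. *)
Lemma arc_antichain s t : s < r -> t < r -> cyclic_arc s \subset cyclic_arc t -> s = t.
Proof.
move=> sr tr /subsetP sub.
have [r1|r2] := leqP r 1; first lia.
have memA y : q s <= y <= arc_end s ->
    exists2 z, q t <= z <= arc_end t & z = y %[mod n].
  move=> ys; have yn : y %% n < n by rewrite ltn_mod.
  have /sub/mem_cyclic_arc[z zt E] : Ordinal yn \in cyclic_arc s by apply/mem_cyclic_arc; exists y.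
  by exists z.
have qs := position_bound perv posv sr; have qt := position_bound perv posv tr.
have et : arc_end t + r <= q t + n.
  by rewrite /arc_end; lia.
have les := arc_start_le_end s.
have [z zt zE] : exists2 z, q t <= z <= arc_end t & z = q s %[mod n].
  by apply: memA; rewrite leqnn.
have [c zc] : exists c, z = q s + c * n.
  exists (z %/ n); rewrite -(modn_small qs) -zE addnC; exact: divn_eq.
(* If the walk from [z] first left the arc of [t] at [z + i.+1], that point would differ from a
   point of the arc by a positive multiple of [n], but the difference is at most [n - r + 1 < n]. *)
have ind i : i <= arc_end s - q s -> z + i <= arc_end t.
  elim: i => [|i IH] ile; first lia.
  have {}IH := IH ltac:(lia).
  have [y yt yE] : exists2 y, q t <= y <= arc_end t & y = q s + i.+1 %[mod n].
    by apply: memA; lia.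
  rewrite leqNgt; apply/negP => lt.
  have E : z + i.+1 = y %[mod n] by rewrite yE zc addnAC addnC modnMDl.
  have : n %| z + i.+1 - y by rewrite -eqn_mod_dvd ?E //; lia.
  by move=> /dvdn_leq; lia.
have {ind} e1 := ind _ (leqnn _).
have e2 : arc_end (s + c * r) <= arc_end t by rewrite arc_end_period; lia.
have q2 : q t <= q (s + c * r) by rewrite (position_periodM perv posv); lia.
have {e2} st : s + c * r <= t.
  by rewrite leqNgt; apply/negP => /arc_end_lt; lia.
have {q2} ts : t <= s + c * r.
  by rewrite leqNgt; apply/negP => /(position_lt posv); lia.
case: c {zc} st ts => [|c]; [lia|rewrite mulSn; lia].
Qed.

Definition rotation : {perm 'I_n} := perm (@ordS_inj n).

Lemma rotation_iter i (x : 'I_n) : iter i rotation x = (x + i) %% n :> nat.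
Proof.
elim: i => [|i IH] /=; first by rewrite addn0 modn_small.
by rewrite permE /= IH -addn1 modnDml addn1 addnS.
Qed.

Lemma arc_sigma_interval t : t < r -> sigma_interval rotation (cyclic_arc t).
Proof.
move=> tr; have qn := position_bound perv posv tr.
have le := arc_start_le_end t.
exists (Ordinal qn), (arc_end t - q t); apply/setP => x; rewrite [RHS]inE.
apply/mem_cyclic_arc/trajectP => [[y yt E]|[i il E]].
  exists (y - q t); first lia.
  by apply: ord_inj; rewrite rotation_iter /= subnKC //; lia.
exists (q t + i); first lia.
by rewrite E rotation_iter.
Qed.

End Arcs.

Lemma rotation_cyclic n : cyclic_perm (rotation n).
Proof.
move=> x y; apply/porbitP; exists (y + (n - x)).
have xn := ltn_ord x; have yn := ltn_ord y.
apply: ord_inj; rewrite permX rotation_iter /= addnCA subnKC; last lia.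
by rewrite modnDr modn_small.
Qed.

(** * Periodic indicators of label sets *)

Section Members.
Variables (n : nat) (B : {set 'I_n}).

(** The indicator of [B] continued with period [n]; searching [enum B] avoids building an ordinal
    from [y %% n]. *)
Definition member (y : nat) := has (fun x => val x == y %% n) (enum B).

Lemma memberE (x : 'I_n) : member x = (x \in B).
Proof.
rewrite /member modn_small //; apply/hasP/idP => [[y]|xB].
  by rewrite mem_enum => yB /eqP/val_inj <-.
by exists x; rewrite ?mem_enum.
Qed.

Lemma member_periodic : periodic n #|B| member.
Proof.
split=> [y|]; first by rewrite /member modnDr.
rewrite /height -val_enum_ord count_map -sum1_card -sum1_count big_enum_cond.
by apply: eq_bigl => x /=; rewrite memberE.
Qed.

End Members.

(** * Lattice paths in terms of heights *)

Definition is_north (s : step) := if s is North then true else false.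

Definition north (W : lattice_path) (y : nat) :=
  is_north (nth East (steps W) (y %% path_length W)).

Lemma height_north (W : lattice_path) j : j <= path_length W ->
  height (north W) j = count is_north (take j (steps W)).
Proof.
move=> jW; rewrite /height -(map_nth_iota0 East jW) count_map.
apply: eq_in_count => y; rewrite mem_iota => yj /=.
by rewrite /north modn_small //; lia.
Qed.

Local Open Scope ring_scope.

Lemma vertexE (W : lattice_path) j :
  vertex W j = ((source W).1 + (count (predC is_north) (take j (steps W)))%:Z,
                (source W).2 + (count is_north (take j (steps W)))%:Z).
Proof.
rewrite /vertex; elim: (take j _) (source W) => [|s l IH] [a b] /=.
  by rewrite !addr0.
by case: s; rewrite IH /= ?PoszD; congr pair; lia.
Qed.

Lemma vertex_sum (W : lattice_path) j :
  (vertex W j).1 + (vertex W j).2 =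
  (source W).1 + (source W).2 + (minn j (path_length W))%:Z.
Proof.
rewrite vertexE /= /path_length -size_take_min.
by have := count_predC is_north (take j (steps W)); lia.
Qed.

Lemma vertex_height (W : lattice_path) j : (j <= path_length W)%N ->
  (vertex W j).2 = (source W).2 + (height (north W) j)%:Z.
Proof. by move=> jW; rewrite height_north // vertexE. Qed.

Lemma vertex_oversize (W : lattice_path) j : (path_length W <= j)%N ->
  vertex W j = target W.
Proof. by move=> h; rewrite /target /vertex !take_oversize. Qed.

Lemma displacement_length (W : lattice_path) (m r : nat) :
  target W = ((source W).1 + m%:Z, (source W).2 + r%:Z) ->
  path_length W = (m + r)%N /\ periodic (m + r) r (north W).
Proof.
rewrite /target vertexE take_size => -[Em Er].
have len : path_length W = (m + r)%N.
  by have := count_predC is_north (steps W); rewrite /path_length; lia.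
split=> //; rewrite -len; split=> [y|]; first by rewrite /north modnDr.
by rewrite height_north // take_size; lia.
Qed.

Section DiagramPaths.
Variable D : diagram.

Lemma length_dP : path_length (dP D) = (dm D + dr D)%N /\
  periodic (dm D + dr D) (dr D) (north (dP D)).
Proof. by apply: displacement_length; rewrite target_dP source_dP /= add0r. Qed.

Lemma length_dQ : path_length (dQ D) = (dm D + dr D)%N /\
  periodic (dm D + dr D) (dr D) (north (dQ D)).
Proof. by apply: displacement_length; rewrite target_dQ source_dQ /= add0r. Qed.

End DiagramPaths.

(** * Traces in the plane, the region and the labels *)

Section Traces.
Variable R : realType.

Lemma vertex_trace (W : lattice_path) j :
  trace R W ((vertex W j).1%:~R, (vertex W j).2%:~R).
Proof.
exists j, 0; first by rewrite lexx ler01.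
by rewrite subr0 !mul1r !mul0r !addr0.
Qed.

(** The coordinate sum grows linearly by 1 along each segment, so an integer value of it is attained
    only at a vertex. *)
Lemma trace_antidiagonal (W : lattice_path) j (a : R * R) :
  (j <= path_length W)%N -> trace R W a ->
  a.1 + a.2 = ((source W).1 + (source W).2 + j%:Z)%:~R ->
  a.2 = (vertex W j).2%:~R.
Proof.
move=> jW [i [t /andP[t0 t1] ->]] /=.
have S k : ((vertex W k).1%:~R : R) + (vertex W k).2%:~R =
    ((source W).1 + (source W).2)%:~R + (minn k (path_length W))%:R.
  by rewrite -intrD vertex_sum intrD.
have := S i; have := S i.+1; rewrite [X in _ -> _ -> _ = X -> _]intrD.
rewrite -[j%:~R]/(j%:R).
(* Beyond the end the segment is degenerate and its only point is the target. *)
have [iW|Wi] := ltnP i (path_length W); last first.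
  rewrite (vertex_oversize Wi) (vertex_oversize (leqW Wi)) => _ E1 E2.
  have : (j%:R : R) = (path_length W)%:R by lra.
  by move=> /eqP; rewrite eqr_nat => /eqP ->; rewrite /target; lra.
rewrite (minn_idPl iW) => E1 E0 E.
have tE : t = j%:R - i%:R.
  have : t * (i.+1%:R - i%:R) = (j%:R : R) - i%:R by nra.
  by rewrite -natr1 addrAC subrr add0r mulr1.
have ij : (i <= j)%N by rewrite -(ler_nat R); lra.
have ji : (j <= i.+1)%N by rewrite -(ler_nat R) -natr1; lra.
have [ije|nij] := eqVneq i j.
  by move: tE; rewrite ije subrr => ->; rewrite subr0 mul1r mul0r addr0.
have ji1 : j = i.+1 by lia.
have -> : t = 1 by rewrite tE ji1 -natr1; lra.
by rewrite ji1 subrr mul0r mul1r add0r.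
Qed.

Variable D : diagram.

(** At a vertex, the antidiagonal meets the traces of [dP D] and [dQ D] only in their vertices;
    between vertices, the inequalities interpolate linearly. *)
Lemma trace_region (W : lattice_path) :
  (source W).1 + (source W).2 = (dk D)%:Z - 1 ->
  path_length W = (dm D + dr D)%N ->
  (trace R W `<=` region R D)%classic <->
  (forall j, (j <= dm D + dr D)%N ->
     (vertex (dP D) j).2 <= (vertex W j).2 <= (vertex (dQ D) j).2).
Proof.
move=> srcW lenW.
have [lenP _] := length_dP D; have [lenQ _] := length_dQ D.
have srcP : (source (dP D)).1 + (source (dP D)).2 = (dk D)%:Z - 1.
  by rewrite source_dP /=; lia.
have srcQ : (source (dQ D)).1 + (source (dQ D)).2 = (dk D)%:Z - 1.
  by rewrite source_dQ /=; lia.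
split=> [sub j jn|H z [j [t /andP[t0 t1] ->]]].
  have [_ [a [b [ta tb sa sb]]]] := sub _ (vertex_trace W j).
  have sW : ((vertex W j).1%:~R : R) + (vertex W j).2%:~R =
      ((dk D)%:Z - 1 + j%:Z)%:~R.
    by rewrite -intrD vertex_sum srcW lenW (minn_idPl jn).
  rewrite (@trace_antidiagonal (dP D) j) ?lenP ?srcP ?sa //.
  by rewrite (@trace_antidiagonal (dQ D) j) ?lenQ ?srcQ ?sb //= !ler_int.
have {}H i : (vertex (dP D) i).2 <= (vertex W i).2 <= (vertex (dQ D) i).2.
  have [|lt] := leqP i (dm D + dr D); first exact: H.
  have := H _ (leqnn _).
  by rewrite !(@vertex_oversize _ i) ?lenP ?lenQ ?lenW 1?ltnW // /target lenP lenQ lenW.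
have S V k : (source V).1 + (source V).2 = (dk D)%:Z - 1 ->
    path_length V = (dm D + dr D)%N ->
    ((vertex V k).1%:~R : R) + (vertex V k).2%:~R =
    (dk D)%:R - 1 + (minn k (dm D + dr D))%:R.
  by move=> sV lV; rewrite -intrD vertex_sum sV lV !intrD rmorphN1.
have SW k := S W k srcW lenW.
have SP k := S _ k srcP lenP.
have SQ k := S _ k srcQ lenQ.
have bnd k : 0 <= ((minn k (dm D + dr D))%:R : R) <= (dm D)%:R + (dr D)%:R.
  by rewrite ler0n -natrD ler_nat geq_minr.
have HR k : ((vertex (dP D) k).2%:~R : R) <= (vertex W k).2%:~R
              <= ((vertex (dQ D) k).2%:~R : R).
  by rewrite !ler_int.
move: (SW j) (SW j.+1) (SP j) (SP j.+1) (SQ j) (SQ j.+1) (bnd j) (bnd j.+1)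
      (HR j) (HR j.+1).
move=> w1 w2 p1 p2 q1 q2 /andP[b1 b1'] /andP[b2 b2'] /andP[h1 h1'] /andP[h2 h2'].
split=> /=; first by apply/andP; split; nra.
(* Using the same [j] and [t] on all three paths puts the points on one antidiagonal. *)
pose pt (V : lattice_path) : R * R :=
  ((1 - t) * (vertex V j).1%:~R + t * (vertex V j.+1).1%:~R,
   (1 - t) * (vertex V j).2%:~R + t * (vertex V j.+1).2%:~R).
exists (pt (dP D)), (pt (dQ D)); split=> /=.
- by exists j, t => //; rewrite t0.
- by exists j, t => //; rewrite t0.
- nra.
- nra.
- by apply/andP; split; apply: lerD; rewrite ler_wpM2l //; lra.
Qed.

(** The coordinate sum at the lower-left end of an edge fixes its step number on every path starting
    on the line L. *)
Lemma label_setE (W : lattice_path) :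
  (source W).1 + (source W).2 = (dk D)%:Z - 1 ->
  path_length W = (dm D + dr D)%N ->
  label_set D W = [set x : 'I_(dm D + dr D) | north W x]%SET.
Proof.
move=> srcW lenW; apply/setP => x; rewrite !inE; apply/asboolP/idP.
  move=> [j [z [[jW E] [V srcV [xV EV]]]]].
  case: E EV => zE nE [zE' _].
  have jx : j = x.+1.
    have := vertex_sum W j.-1; have := vertex_sum V x.
    rewrite -zE -zE' srcW srcV => ->.
    by rewrite /= in xV; rewrite !(minn_idPl _); lia.
  by rewrite jx /= in nE; rewrite /north lenW modn_small // -nE.
rewrite /north lenW modn_small // => nx.
have E : nth East (steps W) x = North by case: nth nx.
by exists x.+1, (vertex W x); split; [|exists W => //]; split; rewrite ?lenW ?ltn_ord //= E.
Qed.

End Traces.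

(* Label-sets described by heights *)
Local Close Scope ring_scope.

(** A path from [p_start D i] corresponds to [s = i - 1]; the inequality at [j = 0] bounds [s] by
    [k - 1], so that [s.+1] is a valid index. *)
Lemma label_setsP (R : realType) (D : diagram) (B : {set 'I_(dm D + dr D)}) :
  label_sets R D B <->
  #|B| = dr D /\ exists s, forall j, j <= dm D + dr D ->
    height (north (dP D)) j <= s + height (member B) j
      <= (dk D).-1 + height (north (dQ D)) j.
Proof.
have [lenP _] := length_dP D; have [lenQ _] := length_dQ D.
have k0 := dk_gt0 D.
have heightE W s : path_length W = dm D + dr D ->
    B = [set x : 'I_(dm D + dr D) | north W x]%SET ->
    (source W).2 = s%:Z%R -> forall j, j <= dm D + dr D ->
    ((vertex (dP D) j).2 <= (vertex W j).2 <= (vertex (dQ D) j).2)%R =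
    (height (north (dP D)) j <= s + height (member B) j
      <= (dk D).-1 + height (north (dQ D)) j).
  move=> lenW BE srcW j jn.
  have -> : height (member B) j = height (north W) j.
    apply: eq_in_count => y; rewrite mem_iota => yj.
    have yn : y < dm D + dr D by lia.
    by rewrite -[y]/(val (Ordinal yn)) memberE BE inE.
  rewrite !vertex_height ?lenP ?lenQ ?lenW // srcW source_dP source_dQ /=; lia.
split.
  move=> [W [sub [i ik [srcW tgtW]]] BE].
  have src : ((source W).1 + (source W).2 = (dk D)%:Z - 1)%R.
    by rewrite srcW /=; lia.
  have [lenW perW] : path_length W = dm D + dr D /\
      periodic (dm D + dr D) (dr D) (north W).
    by apply: displacement_length; rewrite tgtW srcW.
  rewrite (label_setE src lenW) in BE.
  have srcW2 : (source W).2 = i.-1%:Z%R by rewrite srcW /=; lia.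
  have H := heightE W _ lenW BE srcW2.
  move/(trace_region R src lenW): sub => sub.
  split; last by exists i.-1 => j jn; rewrite -H //; exact: sub.
  have [_ cW] := perW; have [_ cB] := member_periodic B.
  apply: etrans cW; apply: etrans (esym cB) _; apply: eq_in_count => y; rewrite mem_iota => yj.
  have yn : y < dm D + dr D by lia.
  by rewrite -[y]/(val (Ordinal yn)) memberE BE inE.
move=> [cB [s Hs]].
pose W := LatticePath (p_start D s.+1)
  [seq if member B y then North else East | y <- iota 0 (dm D + dr D)].
have lenW : path_length W = dm D + dr D by rewrite /path_length size_map size_iota.
have src : ((source W).1 + (source W).2 = (dk D)%:Z - 1)%R by rewrite /=; lia.
have nW y : y < dm D + dr D -> north W y = member B y.
  move=> yn; rewrite /north lenW modn_small // (nth_map 0) ?size_iota //.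
  by rewrite nth_iota //; case: member.
have BE : B = [set x : 'I_(dm D + dr D) | north W x]%SET.
  by apply/setP => x; rewrite inE nW // memberE.
have srcW2 : (source W).2 = s%:Z%R by rewrite /=; lia.
exists W; last by rewrite label_setE.
split.
  by apply/trace_region => // j jn; rewrite (heightE W s) //; exact: Hs.
exists s.+1; first by have := Hs 0 isT; rewrite /height /=; lia.
split=> //; rewrite /target vertexE take_size /p_end.
have cN : count is_north (steps W) = dr D.
  have [_ cB'] := member_periodic B; apply: etrans cB; apply: etrans cB'.
  rewrite -(take_size (steps W)) -height_north // -/(path_length W) lenW.
  by apply: eq_in_count => y; rewrite mem_iota => yj; rewrite nW //; lia.
have := count_predC is_north (steps W); rewrite cN -/(path_length W) lenW.
move=> /eqP; rewrite addnC eqn_add2r => /eqP ->.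
by congr pair; rewrite /=; lia.
Qed.

(** * The arcs as a presentation of the matroid *)

Theorem theorem3p7 (R : realType) (D : diagram) :
  exists2 M : matroid 'I_(dm D + dr D),
    multi_path_matroid M
    & forall B : {set 'I_(dm D + dr D)}, B \in bases M <-> label_sets R D B.
Proof.
set n := dm D + dr D; set K := (dk D).-1; set r := dr D.
set u := north (dP D); set v := north (dQ D).
have [lenP peru] : path_length (dP D) = n /\ periodic n r u := length_dP D.
have [lenQ perv] : path_length (dQ D) = n /\ periodic n r v := length_dQ D.
have uv j : j <= n -> height u j <= K + height v j.
  move=> jn; have := dQ_not_below_dP D j; have k0 := dk_gt0 D.
  rewrite !vertex_height ?lenP ?lenQ // source_dP source_dQ /= /K /u /v; lia.
(* Without North steps there are no crossings; the empty presentation then has the empty set as its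
   only basis. *)
have [r0|r_gt0] := posnP r.
  exists (transversal_matroid (Nil {set 'I_n})).
    exists (rotation n), [::]; split=> //; first exact: rotation_cyclic.
    exact: transversal_presentation.
  move=> B; rewrite label_setsP.
  have t0 : partial_transversal (Nil {set 'I_n}) finset.set0.
    by exists (fun=> 0) => x; rewrite inE.
  have [h1 h2] := transversal_bases B t0 (cards0 _).
  split=> [/h1[_ /= cB]|[cB _]].
    split; first by rewrite cB -r0.
    exists 0 => j jn.
    have hu : height u j <= 0.
      by have [_ cu] := peru; apply: leq_trans (leq_height u jn) _; rewrite cu -r0.
    have hB : height (member B) j <= 0.
      have [_ cB'] := member_periodic B.
      by apply: leq_trans (leq_height _ jn) _; rewrite cB' cB.
    by apply/andP; split; [exact: leq_trans hu _|exact: leq_trans hB _].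
  apply: h2; split; last by rewrite cB -/r r0.
  by have /cards0_eq -> : #|B| = 0 by rewrite cB.
have n_gt0 : 0 < n by rewrite /n -/r; lia.
have {}uv j : height u j <= K + height v j.
  rewrite (height_divn peru) (height_divn perv); have := uv (j %% n).
  by rewrite ltnW ?ltn_mod // => /(_ isT); lia.
have [p posu] := position_exists peru r_gt0.
have [q posv] := position_exists perv r_gt0.
pose A := mkseq (@cyclic_arc n r K p q) r.
have sA : size A = r by rewrite size_mkseq.
have nthA t : t < r -> nth finset.set0 A t = cyclic_arc n r K p q t.
  by move=> tr; rewrite nth_mkseq.
have btwE (B : {set 'I_n}) : #|B| = r -> (partial_transversal A B <-> between u v K (member B)).
  move=> cB; have perB := member_periodic B; rewrite cB in perB.
  split=> [[f finj fA]|btw].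
    (* The matching is carried from ['I_n] to [nat], with default 0 from [n] on. *)
    pose g y := if insub y is Some x then f x else 0.
    have gE (x : 'I_n) : g x = f x by rewrite /g valK.
    apply: (@transversal_between n r K u v p q _ _ _ _ _ _ _ g) => //.
      move=> x y xn yn; rewrite -[x]/(val (Ordinal xn)) -[y]/(val (Ordinal yn)).
      by rewrite !memberE !gE => xB yB /finj E; congr val; exact: E.
    move=> x; rewrite memberE gE => xB.
    have fr : f x < r by rewrite -sA; exact: transversal_lt_size fA _ xB.
    by rewrite -nthA //; split => //; exact: fA.
  have [f finj fA] := between_transversal peru perv r_gt0 uv posu posv perB btw.
  exists (fun x : 'I_n => f x) => [x y xB yB E|x xB].
    by apply: ord_inj; apply: finj => //; rewrite memberE.
  by have [|fr xA] := fA x; [rewrite memberE|rewrite nthA].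
have labelE (B : {set 'I_n}) : label_sets R D B <-> partial_transversal A B /\ #|B| = size A.
  rewrite label_setsP sA -/r -/K -/n -/u -/v; split.
    move=> [cB [s Hs]]; split=> //; apply/btwE => //; exists s => j.
    have perB := member_periodic B; rewrite cB in perB.
    rewrite (height_divn peru) (height_divn perv) (height_divn perB).
    have := Hs (j %% n).
    by rewrite ltnW ?ltn_mod // => /(_ isT); lia.
  move=> [/[swap] cB /(btwE _ cB) [s Hs]]; split=> //; exists s => j _; exact: Hs.
(* The upper path is itself a b-path, so the rank is [r]. *)
pose B0 : {set 'I_n} := [set x : 'I_n | v x]%SET.
have hB0 j : j <= n -> height (member B0) j = height v j.
  move=> jn; apply: eq_in_count => y; rewrite mem_iota => yj.
  have yn : y < n by lia.
  by rewrite -[y]/(val (Ordinal yn)) memberE inE.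
have [t0 c0] : partial_transversal A B0 /\ #|B0| = size A.
  apply/labelE; rewrite label_setsP; split.
    have [_ <-] := member_periodic B0; rewrite hB0 //.
    by case: perv.
  by exists K => j jn; rewrite hB0 // leqnn andbT; exact: uv.
exists (transversal_matroid A); last first.
  by move=> B; rewrite labelE; exact: transversal_bases t0 c0.
exists (rotation n), A; split.
- exact: rotation_cyclic.
- move=> I /mapP[t]; rewrite mem_iota => tr ->.
  exact: arc_sigma_interval peru perv r_gt0 uv posu posv _ tr.
- move=> s t; rewrite sA => sr tr; apply: contraNN; rewrite !nthA // => sub.
  by apply/eqP; exact: arc_antichain peru perv r_gt0 uv posu posv _ _ sr tr sub.
- exact: transversal_presentation.
Qed.
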